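(* Let $b_1,\dots,b_m$ and $c_1,\dots,c_m$ be generic complex numbers, let $a_2\in\mathbb{C}$, and define $m\times m$ matrices $M_0,M_1,M_\infty$ by $$(M_0)_{ij}=\begin{cases}0,& i>j,\\ e^{2\pi\sqrt{-1}\,b_i},& i=j,\\ e^{2\pi\sqrt{-1}\left((j-i-1)a_2+b_j+\sum_{k=i+1}^{j-1}(b_k-c_k)\right)}\left(e^{2\pi\sqrt{-1}(b_i-c_i+a_2)}-1\right),& i<j,\end{cases}$$ $$\left(M_1-e^{2\pi\sqrt{-1}\,a_2}\mathrm{Id}\right)_{ij}=e^{-2\pi\sqrt{-1}\left((i-1)a_2+\sum_{k=1}^{i}(b_k-c_k)\right)}\left(1-e^{2\pi\sqrt{-1}(b_i-c_i+a_2)}\right)\quad\text{for all } i,j,$$ $$(M_\infty)_{ij}=\begin{cases}e^{-2\pi\sqrt{-1}(b_i+a_2)}\left(e^{2\pi\sqrt{-1}(b_i-c_i+a_2)}-1\right),& i>j,\\ e^{-2\pi\sqrt{-1}\,c_i},& i=j,\\ 0,& i<j.\end{cases}$$ Then $M_\infty M_1M_0=\mathrm{Id}$.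
   Context: $\mathrm{Id}$ is the $m\times m$ identity matrix. Empty sums are $0$. *)

(* Defs.v *)
From mathcomp Require Import all_boot all_order all_algebra.
From mathcomp Require Import complex.
From mathcomp Require Import reals sequences exp trigo.

Set Implicit Arguments.
Unset Strict Implicit.
Unset Printing Implicit Defensive.

Import GRing.Theory.

Local Open Scope ring_scope.
Local Open Scope complex_scope.

(* The complex exponential, e^(x + iy) = e^x (cos y + i sin y). *)
Definition cexp (R : realType) (z : R[i]) : R[i] :=
  (expR (complex.Re z))%:C * (cos (complex.Im z) +i* sin (complex.Im z)).

Definition e2pi (R : realType) (z : R[i]) : R[i] :=
  cexp ((2 * pi)%:C * 'i%C * z).

Lemma cexp_real (R : realType) (x : R) : cexp x%:C = (expR x)%:C.
Proof. by rewrite /cexp /= cos0 sin0 mulr1. Qed.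

Lemma cexpD (R : realType) (z w : R[i]) : cexp (z + w) = cexp z * cexp w.
Proof.
case: z w => [x y] [x' y']; rewrite /cexp /= expRD rmorphM /= mulrACA.
congr (_ * _); apply/eqP; rewrite eq_complex /= cosD sinD.
by rewrite eqxx /= addrC eqxx.
Qed.

(* Indices range over 'I_m = {0, ..., m - 1}: the element i : 'I_m stands for
   the 1-based index i + 1, so that (i - 1) a2 in 1-based indexing becomes
   i%:R * a2, and sums over 1 <= k <= i run over the k : 'I_m with k <= i. *)
Section Monodromy.
Variables (R : realType) (m : nat) (b c : 'I_m -> R[i]) (a2 : R[i]).

Definition M0 : 'M[R[i]]_m :=
  \matrix_(i < m, j < m)
    if (j < i)%N then 0
    else if i == j then e2pi (b i)
    else e2pi ((j%:R - i%:R - 1) * a2 + b j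
               + \sum_(k < m | (i < k < j)%N) (b k - c k))
         * (e2pi (b i - c i + a2) - 1).

Definition M1 : 'M[R[i]]_m :=
  (e2pi a2)%:M +
  \matrix_(i < m, j < m)
    (e2pi (- (i%:R * a2 + \sum_(k < m | (k <= i)%N) (b k - c k)))
     * (1 - e2pi (b i - c i + a2))).

Definition Minfty : 'M[R[i]]_m :=
  \matrix_(i < m, j < m)
    if (j < i)%N then e2pi (- (b i + a2)) * (e2pi (b i - c i + a2) - 1)
    else if i == j then e2pi (- c i)
    else 0.

End Monodromy.

(* Main.v *)
Require Import Defs.
From mathcomp Require Import all_boot all_order all_algebra.
From mathcomp Require Import complex.
From mathcomp Require Import reals.
From mathcomp Require Import exp.
From mathcomp Require Import ring zify.

(** Put [q n = e^(- 2 pi i (n a2 + sum_(k < n) (b_k - c_k)))], so that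
    [q i / q (i + 1) = e^(2 pi i (b_i - c_i + a2))].  With [x_i = e^(2 pi i b_i)]
    and [A = e^(2 pi i a2)], the matrix [M1] is [A] times the sum of the identity
    and the rank one matrix whose [i]-th row is constantly [q (i + 1) - q i], and
    every column of [M0] and of
    [M1 M0] is a difference sequence.  The column sums of [M0] thus telescope to
    [x_j / q j], which makes [M1 M0] lower triangular, and the sums in
    [Minfty (M1 M0)] telescope in the same way. *)

Local Open Scope ring_scope.
Local Open Scope complex_scope.

Import GRing.Theory.

Lemma telescope_ord (V : zmodType) (m n : nat) (f : nat -> V) :
  (n <= m)%N -> \sum_(k < m | (k < n)%N) (f k.+1 - f k) = f n - f 0%N.
Proof.
move=> le_nm; rewrite -(big_ord_widen m (fun k => f k.+1 - f k) le_nm).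
by rewrite -(big_mkord xpredT (fun k => f k.+1 - f k)) telescope_sumr.
Qed.

Section AbstractMonodromy.
Variables (F : fieldType) (m : nat) (A : F) (x : 'I_m -> F) (q : nat -> F).

(** With [x] and [q] arbitrary, every entry is a rational expression that [field] can treat. *)
Definition N0 : 'M[F]_m := \matrix_(i, j)
  if (j < i)%N then 0
  else if i == j then x i else x j / q j * (q i - q i.+1).

Definition N1 : 'M[F]_m := A%:M + \matrix_(i, j) (A * (q i.+1 - q i)).

Definition Ninfty : 'M[F]_m := \matrix_(i, j)
  if (j < i)%N then (A * x i)^-1 * (q i / q i.+1 - 1)
  else if i == j then (A * x i)^-1 * (q i / q i.+1) else 0.

Hypotheses (A_neq0 : A != 0) (x_neq0 : forall i, x i != 0).
Hypotheses (q_neq0 : forall n, q n != 0) (q0 : q 0%N = 1).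

(** Up to the factor [A], the sum of the first [n] entries of column [j] of [N1 *m N0]. *)
Let entry_sum (j : 'I_m) (n : nat) : F := if (j < n)%N then x j * q n / q j else 0.

Lemma column_sum (j : 'I_m) : \sum_i N0 i j = x j / q j.
Proof.
(* Partial sums of column [j], shifted by a constant so that [U j = 0]; the diagonal entry is then
   the jump to [x j]. *)
pose U n := if (n <= j)%N then x j * (1 - q n / q j) else x j.
have -> : \sum_i N0 i j = \sum_(i < m | (i < m)%N) (U i.+1 - U i).
  apply: eq_big => [i|i _]; first by rewrite ltn_ord.
  rewrite mxE /U -val_eqE /=; case: (ltngtP i j) => [_|_|/val_inj ->].
  - by field.
  - by rewrite subrr.
  - by rewrite divff // subrr mulr0 subr0.
rewrite telescope_ord // /U leqNgt ltn_ord /= q0; field; exact: q_neq0.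
Qed.

(** The rank one part of [N1] sees only the column sum of [N0]; its contribution cancels [A *: N0]
    above the diagonal. *)
Lemma mul_N1_N0 (i j : 'I_m) : (N1 *m N0) i j = A * (entry_sum j i.+1 - entry_sum j i).
Proof.
rewrite mulmxDl mul_scalar_mx !mxE.
under eq_bigr do rewrite mxE.
rewrite -mulr_sumr column_sum /entry_sum ltnS -val_eqE /=.
by case: (ltngtP i j) => [_|_|/val_inj ->]; field.
Qed.

Lemma monodromy_relation : Ninfty *m N1 *m N0 = 1%:M.
Proof.
apply/matrixP => i j; rewrite -mulmxA mxE.
under eq_bigr do rewrite mul_N1_N0.
(* Row [i] of [Ninfty] is constant left of the diagonal, so that part telescopes; only [k = i]
   survives in the rest. *)
rewrite (bigID (fun k : 'I_m => (k < i)%N)) /=.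
have -> : \sum_(k < m | (k < i)%N) Ninfty i k * (A * (entry_sum j k.+1 - entry_sum j k)) =
    (x i)^-1 * (q i / q i.+1 - 1) * entry_sum j i.
  rewrite -[entry_sum j i]subr0 -[0]/(entry_sum j 0%N) -(telescope_ord F m) ?[(i <= m)%N]ltnW //.
  rewrite mulr_sumr; apply: eq_bigr => k lt_ki.
  by rewrite mxE lt_ki; field; rewrite q_neq0 x_neq0 A_neq0.
rewrite (bigD1 i) ?ltnn //= big1 => [|k /andP[ge_ki ne_ki]]; last first.
  by rewrite mxE (negbTE ge_ki) eq_sym (negbTE ne_ki) mul0r.
(* What remains is [(q i / q i.+1 * entry_sum j i.+1 - entry_sum j i) / x i], which vanishes unless
   [i = j]. *)
rewrite !mxE ltnn eqxx /entry_sum ltnS -val_eqE /=.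
case: (ltngtP i j) => [_|_|/val_inj ->]; rewrite ?mulr0n ?mulr1n; field.
all: by rewrite ?q_neq0 ?x_neq0 ?A_neq0.
Qed.

End AbstractMonodromy.

Section E2pi.
Variable R : realType.
Implicit Types z w : R[i].

Lemma e2piD z w : e2pi (z + w) = e2pi z * e2pi w.
Proof. by rewrite /e2pi mulrDr cexpD. Qed.

Lemma e2pi0 : e2pi (0 : R[i]) = 1.
Proof. by rewrite /e2pi mulr0 (cexp_real 0) expR0. Qed.

Lemma e2pi_neq0 z : e2pi z != 0.
Proof.
apply/eqP => e0; have := e2piD z (- z).
by rewrite subrr e2pi0 e0 mul0r => /eqP; rewrite oner_eq0.
Qed.

Lemma e2piN z : e2pi (- z) = (e2pi z)^-1.
Proof.
by apply: (mulfI (e2pi_neq0 z)); rewrite -e2piD subrr e2pi0 divff ?e2pi_neq0.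
Qed.

Lemma e2piB z w : e2pi (z - w) = e2pi z / e2pi w.
Proof. by rewrite e2piD e2piN. Qed.

End E2pi.

Theorem theorem3p5 (R : realType) (m : nat) (b c : 'I_m -> R[i]) (a2 : R[i]) :
  Minfty b c a2 *m M1 b c a2 *m M0 b c a2 = 1%:M.
Proof.
pose s n : R[i] := \sum_(k < m | (k < n)%N) (b k - c k).
pose q n : R[i] := e2pi (- (n%:R * a2 + s n)).
have sS (i : 'I_m) : s i.+1 = s i + (b i - c i).
  rewrite /s (bigD1 i) ?ltnSn //= addrC; congr (_ + _).
  by apply: eq_bigl => k; rewrite ltnS -val_eqE /= ltn_neqAle andbC.
have s_split (i j : 'I_m) : (i < j)%N ->
    \sum_(k < m | (i < k < j)%N) (b k - c k) = s j - s i.+1.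
  move=> lt_ij; rewrite /s.
  rewrite [\sum_(k < m | (k < j)%N) _](bigID (fun k : 'I_m => (k < i.+1)%N)) /=.
  rewrite [X in X + _ - _](eq_bigl (fun k : 'I_m => (k < i.+1)%N)); last by move=> k /=; lia.
  by rewrite addrC addKr; apply: eq_bigl => k; lia.
have q_ratio (i : 'I_m) : e2pi (b i - c i + a2) = q i / q i.+1.
  by rewrite /q -e2piB sS -natr1; congr e2pi; ring.
have q_neq0 n : q n != 0 by exact: e2pi_neq0.
have q0 : q 0%N = 1 by rewrite /q /s big_pred0 // mul0r addr0 oppr0 e2pi0.
pose x i := e2pi (b i).
have -> : Minfty b c a2 = Ninfty _ m (e2pi a2) x q.
  apply/matrixP => i j; rewrite !mxE -(q_ratio i) -(e2piD _ a2 (b i)) -e2piN [a2 + b i]addrC.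
  case: ifP => // _; case: ifP => // _.
  by rewrite -e2piD; congr e2pi; ring.
have -> : M1 b c a2 = N1 _ m (e2pi a2) q.
  congr (_ + _); apply/matrixP => i j; rewrite !mxE q_ratio.
  (* The exponent pairs [i] copies of [a2] with [i + 1] summands; completing it to [q i.+1] costs a
     factor [e2pi a2]. *)
  have -> : e2pi (- (i%:R * a2 + s i.+1)) = e2pi a2 * q i.+1.
    by rewrite /q -e2piD -natr1; congr e2pi; ring.
  by field.
have -> : M0 b c a2 = N0 _ m x q.
  apply/matrixP => i j; rewrite !mxE.
  case: (ltngtP j i) => [//|lt_ij|/val_inj ->]; last by rewrite eqxx.
  case: ifP => // _; rewrite s_split // q_ratio.
  (* Here [(j - i - 1) * a2] splits as [j * a2 - (i + 1) * a2], matching [s j - s i.+1]. *)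
  have -> : e2pi ((j%:R - i%:R - 1) * a2 + b j + (s j - s i.+1)) =
      x j * q i.+1 / q j.
    by rewrite /q -e2piD -e2piB -natr1; congr e2pi; ring.
  by field; rewrite !q_neq0.
by apply: monodromy_relation => // *; apply: e2pi_neq0.
Qed.
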